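(* There is $n_0$ such that the following holds for all $n \ge n_0$. If $H$ is a $3$-graph on $n$ vertices with minimum $2$-degree $\delta_2(H) \ge n/2$ that does not contain a Fano plane, then $n$ is even and $H$ is a balanced complete bipartite $3$-graph.
   Context: A $k$-graph $H$ consists of a vertex set $V(H)$ and an edge set $E(H)$ of $k$-element subsets of $V(H)$. For $S \subseteq V(H)$, $N_H(S) = \{T \subseteq V(H)\setminus S : S \cup T \in E(H)\}$, and the minimum $s$-degree is $\delta_s(H) = \min_{|S|=s} |N_H(S)|$. The Fano plane is the $3$-graph whose $7$ vertices are the nonzero vectors of $\mathbb{F}_2^3$ and whose $7$ edges are the triples $\{a,b,c\}$ with $a+b=c$. ''$H$ contains $F$'' means $H$ has a (not necessarily induced) subgraph isomorphic to $F$. A complete bipartite $3$-graph on a vertex set partitioned as $A \cup B$ has as edges all triples meeting both $A$ and $B$; it is balanced if $||A|-|B|| \le 1$. *)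

(* Defs.v *)
From mathcomp Require Import all_boot all_order all_algebra.
Set Implicit Arguments. Unset Strict Implicit. Unset Printing Implicit Defensive.
Import GRing.Theory.

Definition is_kgraph (k n : nat) (E : {set {set 'I_n}}) : Prop :=
  forall e, e \in E -> #|e| = k.

Definition nbhd (n : nat) (E : {set {set 'I_n}}) (S : {set 'I_n}) :
  {set {set 'I_n}} :=
  [set T : {set 'I_n} | [disjoint T & S] && ((S :|: T) \in E)].

(* delta_s(H) >= d, i.e. every s-set S has |N_H(S)| >= d (d real: 2|N| >= n
   encodes |N| >= n/2). *)
Definition min_codeg_ge_half (n : nat) (E : {set {set 'I_n}}) : Prop :=
  forall S : {set 'I_n}, #|S| = 2 -> n <= 2 * #|nbhd E S|.

Definition fano_vertices : {set 'cV['F_2]_3} := [set v | v != 0%R].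
Definition fano_edges : {set {set 'cV['F_2]_3}} :=
  [set [set a; b; (a + b)%R] | a in fano_vertices, b in fano_vertices & a != b].

Definition contains_fano (n : nat) (E : {set {set 'I_n}}) : Prop :=
  exists f : 'cV['F_2]_3 -> 'I_n,
    {in fano_vertices &, injective f} /\
    forall e, e \in fano_edges -> f @: e \in E.

Definition complete_bipartite3 (n : nat) (E : {set {set 'I_n}})
  (A : {set 'I_n}) : Prop :=
  forall e : {set 'I_n},
    e \in E <-> [/\ #|e| = 3, e :&: A != set0 & e :&: ~: A != set0].

Definition balanced_complete_bipartite3 (n : nat) (E : {set {set 'I_n}}) :
  Prop :=
  exists A : {set 'I_n},
    complete_bipartite3 E A /\
    (#|A| <= #|~: A| + 1)%N /\ (#|~: A| <= #|A| + 1)%N.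

(* Main.v *)
(* Write N(xy) for the neighbourhood of a pair and U(X) for the union of N(xx')
   over the pairs of X.  If X, Y are 4-sets and X', Y' lie in the common
   neighbourhood of all pairs of X x Y, then a vertex v of U(X), U(Y) and
   U(X') or U(Y') gives a Fano plane: its three lines through v come from pairs
   in X, in Y, and in X' or Y', and the other four are edges X x Y x (X' or Y').
   Averaging and pigeonhole show that every large set contains X, Y with a large
   common neighbourhood.  Choose such X, Y with |U(X) & U(Y)| maximal and then
   such X', Y' inside their common neighbourhood.  Disjointness of U(X) & U(Y)
   from U(X') | U(Y') and maximality give |U(X')| + |U(Y')| <= n.  Hence both
   have size exactly n/2, and every pair of X' has neighbourhood B = U(X').  A
   line inside B together with X' would be a Fano plane, so B is independent
   and pairs of B have neighbourhood ~B; the same argument with B in place of X'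
   shows that pairs of ~B have neighbourhood B. *)
Require Import Defs.
From mathcomp Require Import all_boot all_order all_algebra.
From mathcomp Require Import zify.
Set Implicit Arguments. Unset Strict Implicit. Unset Printing Implicit Defensive.

(** * Counting: many dense sets have a large common intersection *)

Lemma subset_of_card (T : finType) (A : {set T}) k :
  k <= #|A| -> exists2 B : {set T}, B \subset A & #|B| = k.
Proof.
case/card_geqP=> s [us <- sA]; exists [set x in s].
  by apply/subsetP=> x; rewrite inE; apply: sA.
by rewrite cardsE; apply/card_uniqP.
Qed.

Lemma pigeonhole (aT rT : finType) (f : aT -> rT) (A : {set aT}) (B : {set rT}) :
  A != set0 -> {in A, forall x, f x \in B} ->
  exists2 y, y \in B & #|A| <= #|B| * #|[set x in A | f x == y]|.
Proof.
case/set0Pn=> x0 Ax0 fAB.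
case: (arg_maxnP (fun y => #|[set x in A | f x == y]|) (fAB _ Ax0)) => y By maxy.
exists y => //; rewrite -sum1_card (partition_big f (mem B)) //=.
rewrite -sum_nat_const; apply: leq_sum => z Bz.
rewrite sum1_card; apply: leq_trans (maxy z Bz).
by rewrite leq_eqVlt -[in X in X || _]cardsE eqxx.
Qed.

(** Double counting over [m] of the sets shows that a positive proportion of the points lie in at
    least [t] of them. Each such point selects [t] of these indices; as there are at most [2 ^ m]
    selections, a constant fraction of the points agree on one. *)
Lemma large_common_intersection (q t : nat) :
  exists m q' : nat, forall (I V : finType) (N : I -> {set V}) (A : {set I}),
    0 < #|V| -> m <= #|A| -> {in A, forall i, #|V| <= q * #|N i|} ->
    exists J : {set I}, [/\ J \subset A, #|J| = t
                         & #|V| <= q' * #|\bigcap_(i in J) N i|].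
Proof.
(* As [m > 2 * q * t], points lying in fewer than [t] sets carry at most half of the incidences. In
   [q'], the factor [2 * q] pays for passing to [G] and [2 ^ m] for the pigeonhole. *)
pose m := (2 * q * t).+1; exists m, (2 * q * 2 ^ m) => I V N A V_gt0 mA bigN.
have [A' sA'A cA'] := subset_of_card mA.
pose S v := [set i in A' | v \in N i].
pose G := [set v | t <= #|S v|].
have sumS : \sum_(i in A') #|N i| = \sum_v #|S v|.
  transitivity (\sum_(i in A') \sum_v (v \in N i : nat)).
    by apply: eq_bigr => i _; rewrite -sum1_card big_mkcond.
  rewrite exchange_big /=; apply: eq_bigr => v _.
  rewrite -sum1_card big_mkcond [RHS]big_mkcond.
  by apply: eq_bigr => i _; rewrite inE; case: (_ \in A').
have lowS : m * #|V| <= q * \sum_v #|S v|.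
  rewrite -sumS -cA' -sum_nat_const big_distrr; apply: leq_sum => i A'i.
  exact/bigN/(subsetP sA'A).
have upS : \sum_v #|S v| <= #|V| * t + #|G| * m.
  rewrite -!sum_nat_const [X in _ <= _ + X]big_mkcond -big_split /=.
  apply: leq_sum => v _; rewrite inE.
  have : #|S v| <= m.
    by rewrite -cA'; apply/subset_leq_card/subsetP=> i; rewrite inE; case/andP.
  by case: (leqP t); lia.
have bigG : #|V| <= 2 * q * #|G|.
  have m_gt0 : 0 < m by [].
  rewrite -(leq_pmul2l m_gt0).
  have : m * #|V| <= q * (#|V| * t + #|G| * m).
    by apply: leq_trans lowS _; rewrite leq_mul2l upS orbT.
  have mV : m * #|V| = 2 * (q * (#|V| * t)) + #|V| by rewrite /m; nia.
  rewrite mulnDr mV.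
  have -> : m * (2 * q * #|G|) = 2 * (q * (#|G| * m)) by nia.
  lia.
have G0 : G != set0 by rewrite -card_gt0; case: (#|G|) bigG => //; rewrite muln0; lia.
pose f v := odflt set0 [pick J : {set I} | (J \subset S v) && (#|J| == t)].
have fP v : v \in G -> f v \subset S v /\ #|f v| = t.
  rewrite inE => /subset_of_card [J sJ cJ]; rewrite /f.
  by case: pickP => [K /andP[sK /eqP]|/(_ J)]; rewrite ?sJ ?cJ ?eqxx.
have fB : {in G, forall v, f v \in powerset A'}.
  move=> v /fP[sfS _]; rewrite inE; apply: subset_trans sfS _.
  by apply/subsetP=> i; rewrite inE; case/andP.
have [J] := pigeonhole G0 fB; rewrite inE card_powerset cA' => sJA' bigJ.
have [v Gv /eqP fv] : exists2 v, v \in G & f v == J.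
  have : 0 < #|[set v in G | f v == J]|.
    rewrite lt0n; apply: contraNneq G0 => c0; rewrite -cards_eq0 -leqn0.
    by rewrite c0 muln0 in bigJ.
  by case/card_gt0P=> v; rewrite inE => /andP[]; exists v.
exists J; split; first exact: subset_trans sA'A.
  by rewrite -fv; case: (fP _ Gv).
apply: leq_trans bigG _; rewrite -(mulnA (2 * q)) leq_mul2l; apply/orP; right.
apply: leq_trans bigJ _; rewrite leq_mul2l; apply/orP; right.
apply/subset_leq_card/subsetP=> w; rewrite inE => /andP[Gw /eqP fw].
apply/bigcapP=> i; rewrite -fw => /(subsetP (fP _ Gw).1).
by rewrite inE; case/andP.
Qed.

(** * Neighbourhoods of pairs *)

Section Graph.
Variables (n : nat) (E : {set {set 'I_n}}).
Implicit Types (x y z v : 'I_n) (X Y S : {set 'I_n}).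

Definition nb x y : {set 'I_n} := [set z | [set x; y; z] \in E].

Definition joint X Y : {set 'I_n} :=
  [set z | [forall x in X, forall y in Y, z \in nb x y]].

(* The two points chosen in [X] are automatically distinct when all edges have
   three elements. *)
Definition shadow X : {set 'I_n} :=
  [set z | [exists x in X, exists y in X, z \in nb x y]].

Lemma nbE x y z : (z \in nb x y) = ([set x; y; z] \in E).
Proof. by rewrite inE. Qed.

Lemma nb_sym x y : nb x y = nb y x.
Proof. by apply/setP=> z; rewrite !nbE (setUC [set x]). Qed.

Lemma nb_rot x y z : (z \in nb x y) = (x \in nb y z).
Proof. by rewrite !nbE -setUA setUC. Qed.

Lemma nb_swap x y z : (z \in nb x y) = (y \in nb x z).
Proof. by rewrite nb_rot (nb_sym y) -nb_rot. Qed.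

Lemma jointP X Y z :
  reflect (forall x y, x \in X -> y \in Y -> z \in nb x y) (z \in joint X Y).
Proof.
rewrite inE; apply: (iffP forall_inP) => XY x => [y Xx|Xx].
  by move/forall_inP: (XY x Xx); apply.
by apply/forall_inP=> y; apply: XY.
Qed.

Lemma shadowP X z :
  reflect (exists x y, [/\ x \in X, y \in X & z \in nb x y]) (z \in shadow X).
Proof.
rewrite inE; apply: (iffP exists_inP) => [[x Xx /exists_inP[y Xy xyz]]|[x [y [Xx Xy xyz]]]].
  by exists x, y.
by exists x => //; apply/exists_inP; exists y.
Qed.

Hypothesis E3 : is_kgraph 3 E.

Lemma nb_neq x y z : z \in nb x y -> [/\ x != y, y != z & x != z].
Proof.
rewrite nbE => /E3 c3; split; apply/eqP=> exy; move: c3; rewrite exy.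
- by rewrite setUid cards2; case: eqP.
- by rewrite -setUA setUid cards2; case: eqP.
- by rewrite setUAC setUid cards2; case: eqP.
Qed.

(** Edges have three elements, so the members of [nbhd E [set x; y]] are singletons; this turns the
    codegree condition into one on sets of vertices. *)
Lemma card_nb x y : x != y -> #|nbhd E [set x; y]| = #|nb x y|.
Proof.
move=> xy; rewrite -[RHS](card_imset _ set1_inj); apply: eq_card => T.
rewrite inE; apply/andP/imsetP => [[dT ET]|[z]].
  have cT : #|[set x; y] :|: T| = 2 + #|T|.
    by rewrite cardsU disjoint_setI0 1?disjoint_sym // cards0 subn0 cards2 xy.
  move: (E3 ET); rewrite cT => -[/eqP/cards1P[z defT]].
  by exists z; rewrite // nbE -defT.
move=> xyz ->; have [_ yz xz] := nb_neq xyz; rewrite nbE in xyz; split=> //.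
by rewrite disjoints1 !inE !negb_or !(eq_sym z) xz.
Qed.

Hypothesis codeg : min_codeg_ge_half E.

Lemma nb_half x y : x != y -> n <= 2 * #|nb x y|.
Proof. by move=> xy; rewrite -card_nb //; apply: codeg; rewrite cards2 xy. Qed.
End Graph.

(** * Small sets with a large joint neighbourhood *)

(** The intersection lemma first gives each [x] outside a bounded set [W] a [t]-set in [W]; many [x]
    share the same [Y], and a second application to their common neighbourhoods gives [X]. The same
    [M] bounds [S] and the joint neighbourhood, so the result can be reapplied inside the latter. *)
Lemma dense_bipartite_pairs (t : nat) : exists M n0 : nat, forall n (E : {set {set 'I_n}}),
  n0 <= n -> is_kgraph 3 E -> min_codeg_ge_half E ->
  forall S : {set 'I_n}, M <= #|S| ->
  exists X Y : {set 'I_n},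
    [/\ X \subset S, Y \subset S, #|X| = t, #|Y| = t & M <= #|joint E X Y|].
Proof.
have [m1 [q1 core1]] := large_common_intersection 2 t.
have [m2 [q2 core2]] := large_common_intersection q1 t.
(* [W] takes [m1] vertices of [S], and [k] others leave [m2] after the pigeonhole over the [2 ^ m1]
   subsets of [W]. *)
pose k := (2 ^ m1 * m2).+1.
exists (m1 + k), (q2 * (m1 + k)).+1 => n E n_big E3 codeg S S_big.
have n_gt0 : 0 < #|'I_n| by rewrite card_ord; lia.
have [W sWS cW] : exists2 W : {set 'I_n}, W \subset S & #|W| = m1.
  by apply: subset_of_card; lia.
(* Removing [W] makes every pair in [Z] x [W] consist of distinct vertices, as the codegree bound
   requires. *)
pose Z := S :\: W.
have cZ : k <= #|Z|.
  rewrite cardsD; have : #|S :&: W| <= #|W| by apply/subset_leq_card/subsetIr.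
  lia.
have exY x : exists J : {set 'I_n}, x \in Z ->
   [/\ J \subset W, #|J| = t & #|'I_n| <= q1 * #|\bigcap_(y in J) nb E x y|].
  case: (boolP (x \in Z)) => [Zx|_]; last by exists set0.
  have [||J] := core1 'I_n 'I_n (nb E x) W n_gt0; first by rewrite cW.
    move=> y Wy; rewrite card_ord nb_half //; apply: contraTneq Zx => ->.
    by rewrite inE Wy.
  by exists J.
have [f fP] := fin_all_exists exY.
have Z0 : Z != set0 by rewrite -card_gt0; apply: leq_trans cZ.
have fB : {in Z, forall x, f x \in powerset W}.
  by move=> x /fP[]; rewrite inE.
have [Y] := pigeonhole Z0 fB; rewrite inE card_powerset cW => sYW.
set Z' := [set x in Z | f x == Y] => cZ'.
have Z'P x : x \in Z' -> x \in Z /\ f x = Y by rewrite inE => /andP[? /eqP].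
have m2Z' : m2 <= #|Z'|.
  have := leq_trans cZ cZ'; rewrite /k => lt.
  have : 2 ^ m1 * m2 < 2 ^ m1 * #|Z'| by [].
  by rewrite ltn_mul2l => /andP[_ /ltnW].
have [|X [sXZ' cX joint_big]] :=
    core2 'I_n 'I_n (fun x => \bigcap_(y in Y) nb E x y) Z' n_gt0 m2Z'.
  by move=> x /Z'P[Zx <-]; case: (fP _ Zx).
have cY : #|Y| = t.
  have : 0 < #|Z'|.
    rewrite lt0n; apply: contraNneq Z0 => c0; rewrite -cards_eq0 -leqn0.
    by rewrite c0 muln0 in cZ'.
  by case/card_gt0P=> x /Z'P[Zx <-]; case: (fP _ Zx).
exists X, Y; split=> //.
- by apply: subset_trans sXZ' _; apply/subsetP=> x /Z'P[]; rewrite inE => /andP[].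
- exact: subset_trans sWS.
have -> : joint E X Y = \bigcap_(x in X) \bigcap_(y in Y) nb E x y.
  apply/setP=> z; apply/jointP/bigcapP => [XY x Xx|XY x y Xx Yy].
    by apply/bigcapP=> y Yy; exact: XY.
  by move/bigcapP: (XY x Xx); exact.
have q2_gt0 : 0 < q2 by have := leq_trans n_gt0 joint_big; rewrite muln_gt0 => /andP[].
rewrite -(leq_pmul2l q2_gt0); apply: leq_trans joint_big.
by rewrite card_ord; apply: leq_trans (leqnSn _) n_big.
Qed.

(** * Configurations that force a Fano plane *)

Section Fano.
Variables (n : nat) (E : {set {set 'I_n}}).
Hypothesis E3 : is_kgraph 3 E.

(* With [a = 100], [x = 010], [y = 001] and [z = x + y], the primed points are
   obtained by adding [a]. *)
Lemma contains_fano_lines (a x x' y y' z z' : 'I_n) :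
  x' \in nb E a x -> y' \in nb E a y -> z' \in nb E a z ->
  z \in nb E x y -> z' \in nb E x y' -> z' \in nb E x' y -> z \in nb E x' y' ->
  contains_fano E.
Proof.
(* All six orderings of each of the seven lines enter the context, so that the case analysis in [gE]
   closes by assumption. *)
have perm p q r : r \in nb E p q ->
    [&& r \in nb E p q, r \in nb E q p, q \in nb E p r, q \in nb E r p,
        p \in nb E q r & p \in nb E r q].
  move=> h; rewrite (nb_sym E q p) (nb_sym E r p) (nb_sym E r q).
  by rewrite -(nb_swap E p q r) -(nb_rot E p q r) h.
move=> /perm/and5P[? ? ? ? /andP[? ?]] /perm/and5P[? ? ? ? /andP[? ?]] /perm/and5P[? ? ? ? /andP[? ?]].
move=> /perm/and5P[? ? ? ? /andP[? ?]] /perm/and5P[? ? ? ? /andP[? ?]] /perm/and5P[? ? ? ? /andP[? ?]].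
move=> /perm/and5P[? ? ? ? /andP[? ?]].
(* Booleans encode coordinates over ['F_2], with exclusive or as addition; the value at the zero
   triple is a placeholder. *)
pose g b1 b2 b3 := match b1, b2, b3 with
  | true, false, false => a
  | false, true, false => x
  | true, true, false => x'
  | false, false, true => y
  | true, false, true => y'
  | false, true, true => z
  | true, true, true => z'
  | false, false, false => a
  end.
have gE b1 b2 b3 c1 c2 c3 : [|| b1, b2 | b3] -> [|| c1, c2 | c3] ->
    [|| b1 != c1, b2 != c2 | b3 != c3] ->
    g (b1 (+) c1) (b2 (+) c2) (b3 (+) c3) \in nb E (g b1 b2 b3) (g c1 c2 c3).
  by case: b1; case: b2; case: b3; case: c1; case: c2; case: c3.
have F2 (u : 'F_2) : u = 0%R \/ u = 1%R.
  by case: u => [[|[|]] // lt_u]; [left | right]; apply/val_inj.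
have F2D (u v : 'F_2) : ((u + v)%R != 0%R) = (u != 0%R) (+) (v != 0%R).
  by case: (F2 u) => ->; case: (F2 v) => ->.
have F2I (u v : 'F_2) : (u != 0%R) = (v != 0%R) -> u = v.
  by case: (F2 u) => ->; case: (F2 v) => ->.
pose i0 : 'I_3 := inord 0; pose i1 : 'I_3 := inord 1; pose i2 : 'I_3 := inord 2.
have I3 (u v : 'cV['F_2]_3) : u != v ->
    [|| (u i0 0%R != 0%R) != (v i0 0%R != 0%R),
        (u i1 0%R != 0%R) != (v i1 0%R != 0%R) |
        (u i2 0%R != 0%R) != (v i2 0%R != 0%R)].
  apply: contraR; rewrite !negb_or !negbK => /and3P[/eqP/F2I e0 /eqP/F2I e1 /eqP/F2I e2].
  apply/eqP/colP=> i.
  have : [|| i == i0, i == i1 | i == i2].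
    by case: i => [[|[|[|]]] lt_i] //; rewrite -!val_eqE /= !inordK.
  by case/or3P=> /eqP->.
pose f (v : 'cV['F_2]_3) := g (v i0 0%R != 0%R) (v i1 0%R != 0%R) (v i2 0%R != 0%R).
have fE u v : u \in fano_vertices -> v \in fano_vertices -> u != v ->
    f (u + v)%R \in nb E (f u) (f v).
  rewrite !inE => /I3; rewrite !mxE eqxx /= !eqbF_neg !negbK => u0.
  move=> /I3; rewrite !mxE eqxx /= !eqbF_neg !negbK => v0 /I3 uv.
  by rewrite -nbE /f !mxE !F2D; apply: gE.
exists f; split=> [u v u0 v0 fuv|e /imset2P[u v u0]].
  apply/eqP; apply: contraT => /(fE _ _ u0 v0)/(nb_neq E3)[].
  by rewrite fuv eqxx.
rewrite inE => /andP[v0 uv] ->.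
by rewrite !imsetU !imset_set1 -nbE fE.
Qed.

Hypothesis nofano : ~ contains_fano E.

Lemma shadows_disjoint (X Y X' Y' : {set 'I_n}) (v : 'I_n) :
  X' \subset joint E X Y -> Y' \subset joint E X Y ->
  v \in shadow E X -> v \in shadow E Y -> v \notin shadow E X' :|: shadow E Y'.
Proof.
move=> sX' sY' /shadowP[x [x' [Xx Xx' vx]]] /shadowP[y [y' [Yy Yy' vy]]].
have join z : z \in X' :|: Y' -> forall p q, p \in X -> q \in Y -> z \in nb E p q.
  by move=> X'z; apply/jointP; case/setUP: X'z => [/(subsetP sX')|/(subsetP sY')].
apply/negP=> h; apply: nofano.
have [z [z' [X'z X'z' vz]]] : exists z z',
    [/\ z \in X' :|: Y', z' \in X' :|: Y' & v \in nb E z z'].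
  by case/setUP: h => /shadowP[z [z' [Zz Zz' vz]]]; exists z, z'; split=> //;
    rewrite in_setU ?Zz ?Zz' ?orbT.
apply: (@contains_fano_lines v x x' y y' z z'); try by rewrite nb_rot.
all: exact: join.
Qed.

(** Off a line of the Fano plane lie four points, whose six pairs form three perfect matchings, one
    for each point of the line. An edge inside [B] and four vertices of [X] realise this. *)
Lemma independent_joint (X B : {set 'I_n}) : 4 <= #|X| ->
  (forall x x', x \in X -> x' \in X -> x != x' -> B \subset nb E x x') ->
  forall a b c, a \in B -> b \in B -> c \in B -> c \notin nb E a b.
Proof.
move=> X4 XB a b c Ba Bb Bc.
have {X4}[s [us s4 sX]] := card_geqP X4.
case: s => [|x1 [|x2 [|x3 [|x4 []]]]] //= in us s4 sX *.
move: us; rewrite !inE !negb_or -!andbA => /and5P[x12 x13 x14 x23 /and3P[x24 x34 _]].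
have X1 : x1 \in X by apply: sX; rewrite !inE eqxx ?orbT.
have X2 : x2 \in X by apply: sX; rewrite !inE eqxx ?orbT.
have X3 : x3 \in X by apply: sX; rewrite !inE eqxx ?orbT.
have X4 : x4 \in X by apply: sX; rewrite !inE eqxx ?orbT.
have adj d p q : d \in B -> p \in X -> q \in X -> p != q -> q \in nb E d p.
  by move=> Bd Xp Xq pq; rewrite nb_sym nb_swap; apply: (subsetP (XB p q Xp Xq pq)).
rewrite -nbE; apply/negP=> abc; apply: nofano.
by apply: (@contains_fano_lines a b c x1 x2 x3 x4) => //; exact: adj.
Qed.

Hypothesis codeg : min_codeg_ge_half E.

(** Independence of [B] puts the neighbourhood inside [~: B], which has exactly [n/2] elements; the
    codegree bound forces equality. *)
Lemma nb_other_side (X B : {set 'I_n}) : 4 <= #|X| -> 2 * #|B| = n ->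
  (forall x x', x \in X -> x' \in X -> x != x' -> B \subset nb E x x') ->
  forall b b', b \in B -> b' \in B -> b != b' -> nb E b b' = ~: B.
Proof.
move=> X4 cB XB b b' Bb Bb' bb'.
have indB := independent_joint X4 XB.
apply/eqP; rewrite eqEcard; apply/andP; split.
  by apply/subsetP=> c bc; rewrite inE; apply: contraL bc => /(indB _ _ _ Bb Bb').
have := cardsC B; rewrite card_ord; have := nb_half E3 codeg bb'; lia.
Qed.

End Fano.

(** * From neighbourhoods of pairs to the bipartition *)

Lemma card3P (T : finType) (e : {set T}) : #|e| = 3 ->
  exists x y z, [/\ x != y, y != z, x != z & e = [set x; y; z]].
Proof.
move=> e3; have /card_gt2P[x [y [z [[ex ey ez] [xy yz zx]]]]] : 2 < #|e| by rewrite e3.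
exists x, y, z; rewrite (eq_sym x z); split=> //.
apply/esym/eqP; rewrite eqEcard; apply/andP; split.
  by apply/subsetP=> w; rewrite !inE => /orP[/orP[]|] /eqP->.
by rewrite e3 setUC cardsU1 cards2 !inE xy negb_or zx eq_sym yz.
Qed.

Lemma bipartite_of_pairs n (E : {set {set 'I_n}}) (B : {set 'I_n}) :
  is_kgraph 3 E ->
  (forall x y, x != y -> (x \in B) = (y \in B) ->
     forall z, (z \in nb E x y) = ((z \in B) != (x \in B))) ->
  complete_bipartite3 E B.
Proof.
move=> E3 nbB e.
suff Ee : #|e| = 3 -> (e \in E) = (e :&: B != set0) && (e :&: ~: B != set0).
  split=> [eE|[e3 eB eB']]; last by rewrite Ee // eB.
  by have e3 := E3 e eE; move: eE; rewrite Ee // => /andP[].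
case/card3P=> x [y [z [xy yz xz ->]]].
have meet C : ([set x; y; z] :&: C != set0) = [|| x \in C, y \in C | z \in C].
  by rewrite !setIUl !setU_eq0 !setI_eq0 !disjoints1 !negb_and !negbK orbA.
rewrite !meet !inE -nbE.
(* Two of three vertices lie on the same side; rotating or swapping brings such a pair to the
   front. *)
case xB: (x \in B); case yB: (y \in B); case zB: (z \in B).
all: first [by rewrite nbB ?xB ?yB ?zB | by rewrite nb_rot nbB ?xB ?yB ?zB
           | by rewrite nb_swap nbB ?xB ?yB ?zB].
Qed.

Theorem mainTheorem1 :
  exists n0 : nat, forall (n : nat) (E : {set {set 'I_n}}),
    n0 <= n ->
    is_kgraph 3 E ->
    min_codeg_ge_half E ->
    ~ contains_fano E ->
    ~~ odd n /\ balanced_complete_bipartite3 E.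
Proof.
have [M [n0 dense]] := dense_bipartite_pairs 4.
(* [M] lets [dense] start from the whole vertex set; [8] gives [B], of size [n/2], the four vertices
   required when it replaces [X']. *)
exists (n0 + M + 8) => n E n_big E3 codeg nofano.
have {}dense (S : {set 'I_n}) : M <= #|S| -> exists p : {set 'I_n} * {set 'I_n},
    [/\ p.1 \subset S, p.2 \subset S, #|p.1| = 4 & #|p.2| = 4 /\ M <= #|joint E p.1 p.2|].
  move=> MS; have n0n : n0 <= n by lia.
  by have [X [Y [? ? ? ? ?]]] := dense n E n0n E3 codeg S MS; exists (X, Y).
pose good (p : {set 'I_n} * {set 'I_n}) := M <= #|joint E p.1 p.2|.
have [p0 good0] : exists p, good p.
  have [|p [_ _ _ [_ gp]]] := dense [set: 'I_n]; first by rewrite cardsT card_ord; lia.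
  by exists p.
have [[X Y] gXY maxXY] := arg_maxnP (fun p => #|shadow E p.1 :&: shadow E p.2|) good0.
have [[X' Y'] /= [sX' sY' X'4 [Y'4 gXY']]] := dense _ gXY.
(* The sum is the union plus the intersection of the two shadows. By maximality the intersection is
   no larger than that of the shadows of [X] and [Y], which is disjoint from the union. *)
have le_n : #|shadow E X'| + #|shadow E Y'| <= n.
  rewrite -cardsUI.
  have max' : #|shadow E X' :&: shadow E Y'| <= #|shadow E X :&: shadow E Y|.
    exact: (maxXY (X', Y') gXY').
  have : [disjoint shadow E X :&: shadow E Y & shadow E X' :|: shadow E Y'].
    rewrite disjoint_subset; apply/subsetP=> v; rewrite inE => /andP[vX vY].
    exact: (shadows_disjoint E3 nofano sX' sY').
  rewrite disjoint_sym -setI_eq0 => /eqP dis.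
  have := cardsUI (shadow E X' :|: shadow E Y') (shadow E X :&: shadow E Y).
  rewrite dis cards0 addn0 => cU; apply: leq_trans (leq_add (leqnn _) max') _.
  by rewrite -cU -[X in _ <= X]card_ord max_card.
have nb_shadow (Z : {set 'I_n}) x x' : x \in Z -> x' \in Z -> nb E x x' \subset shadow E Z.
  by move=> Zx Zx'; apply/subsetP=> v vx; apply/shadowP; exists x, x'.
have shadow_half (Z : {set 'I_n}) : #|Z| = 4 -> n <= 2 * #|shadow E Z|.
  move=> Z4; have /card_gt1P[x [x' [Zx Zx' xx']]] : 1 < #|Z| by rewrite Z4.
  apply: leq_trans (nb_half E3 codeg xx') _.
  by rewrite leq_mul2l (subset_leq_card (nb_shadow _ _ _ Zx Zx')) orbT.
have hX := shadow_half _ X'4; have hY := shadow_half _ Y'4.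
pose B := shadow E X'.
(* Two shadows of size at least [n/2] with total at most [n] both have size exactly [n/2]; in
   particular [n] is even. *)
have cB : 2 * #|B| = n by rewrite /B; lia.
have cB' : 2 * #|~: B| = n by have := cardsC B; rewrite card_ord; lia.
have X'B x x' : x \in X' -> x' \in X' -> x != x' -> B \subset nb E x x'.
  move=> Xx Xx' xx'; have /eqP-> : nb E x x' == B; last by [].
  by rewrite eqEcard nb_shadow //= -(leq_pmul2l (isT : 0 < 2)) cB nb_half.
have BB := nb_other_side E3 nofano codeg (eq_leq (esym X'4)) cB X'B.
have AA a a' : a \in ~: B -> a' \in ~: B -> a != a' -> nb E a a' = B.
  rewrite -[RHS]setCK; apply: (nb_other_side E3 nofano codeg (X := B)) => //; first by lia.
  by move=> b b' Bb Bb' bb'; rewrite BB.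
clearbody B; split; first by lia.
exists B; split; last by lia.
apply: bipartite_of_pairs => // x y xy sxy z.
case xB: (x \in B) sxy => /esym yB; first by rewrite BB // in_setC; case: (_ \in B).
by rewrite AA ?in_setC ?xB ?yB //; case: (_ \in B).
Qed.
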